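(* For any finite, simple, undirected, connected graphs $G$ and $H$, $${\rm dmg}(G\square H)\le \max\big\{{\rm dmg}(G)\,|V(H)|,\ {\rm dmg}'(H)\,|V(G)|\big\}.$$
   Context: The Cartesian product $G\square H$ has vertex set $V(G)\times V(H)$, with $(u,v)\sim(u',v')$ iff ($u=u'$ and $vv'\in E(H)$) or ($v=v'$ and $uu'\in E(G)$). Damage game on a graph: one cop and one robber; in round $0$ the cop chooses a vertex, then the robber does; in each later round the cop moves to an adjacent vertex or passes, then the robber moves to an adjacent vertex or passes; the robber is captured if the cop occupies the robber's vertex. A vertex $v$ is damaged if the robber occupies $v$ in some round $i\ge0$ and in round $i+1$ the uncaptured robber passes or moves to a neighbour. The damage number ${\rm dmg}(\cdot)$ is the number of distinct vertices damaged when the cop plays to minimize and the robber to maximize this number. ${\rm dmg}'(H)$ is the analogous optimal-play value for the modified game on $H$ in which the cop is required to pass during round $1$. *)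

(* Defs.v *)
From mathcomp Require Import all_boot.
From mathcomp Require Import boolp.

Set Implicit Arguments.
Unset Strict Implicit.
Unset Printing Implicit Defensive.

(* Graphs are adjacency relations on finite types; connected graphs are
   nonempty. *)
Definition simple_graph (T : finType) (e : rel T) : Prop :=
  symmetric e /\ irreflexive e.

Definition connected_graph (T : finType) (e : rel T) : Prop :=
  0 < #|T| /\ forall x y : T, connect e x y.

Definition box (T U : finType) (e : rel T) (f : rel U) : rel (T * U)%type :=
  fun p q => ((p.1 == q.1) && f p.2 q.2) || ((p.2 == q.2) && e p.1 q.1).

Section Game.

Variables (T : finType) (e : rel T).

Definition step (x y : T) : bool := (y == x) || e x y.

(* The history before round n lists the (cop, robber) positions at the end of
   rounds 0, ..., n-1.  The cop plays first in each round, so the robber also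
   sees the position that the cop has just taken. *)
Definition cop_strategy := seq (T * T) -> T.
Definition robber_strategy := seq (T * T) -> T -> T.

(* The choice in round 0, at the empty history, is unrestricted. *)
Definition cop_legal (s : cop_strategy) : Prop :=
  forall h c r, step c (s (rcons h (c, r))).

Definition robber_legal (t : robber_strategy) : Prop :=
  forall h c r c', step r (t (rcons h (c, r)) c').

Definition passes_in_round1 (s : cop_strategy) : Prop :=
  forall c r, s [:: (c, r)] = c.

Fixpoint history (s : cop_strategy) (t : robber_strategy) (n : nat) :
    seq (T * T) :=
  if n is m.+1 then
    let h := history s t m in rcons h (s h, t h (s h))
  else [::].

Definition cop_at s t n : T := s (history s t n).
Definition robber_at s t n : T := t (history s t n) (cop_at s t n).

(* Capture happens either at the end of a round j (possibly because the robber
   places himself on, or moves onto, the cop) or by the cop's move in round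
   j.+1.  Positions after a capture are fictitious and never count as damage. *)
Definition uncaptured_after_cop_move s t (i : nat) : Prop :=
  forall j, j <= i ->
    cop_at s t j <> robber_at s t j /\ cop_at s t j.+1 <> robber_at s t j.

(* In round i.+1 a robber who is still uncaptured after the cop's move passes
   or moves to a neighbour by legality, which damages his round-i vertex. *)
Definition damaged s t (v : T) : Prop :=
  exists i, robber_at s t i = v /\ uncaptured_after_cop_move s t i.

Definition damage s t : nat := #|[set v | `[< damaged s t v >]]|.

Definition cop_ensures (allowed : cop_strategy -> Prop) (k : nat) : Prop :=
  exists s, [/\ cop_legal s, allowed s &
    forall t, robber_legal t -> damage s t <= k].

(* The min over allowed cop strategies of the max over robber strategies of
   the damage, i.e. the least k that the cop can ensure; k = #|T| is always
   ensured when T is nonempty (game_valueP). *)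
Definition game_value (allowed : cop_strategy -> Prop) : nat :=
  [arg min_(k < @ord_max #|T| | `[< cop_ensures allowed k >]) (k : nat)].

Definition dmg : nat := game_value (fun=> True).

Definition dmg' : nat := game_value passes_in_round1.

Lemma game_valueP (allowed : cop_strategy -> Prop) (s : cop_strategy) :
  cop_legal s -> allowed s ->
  cop_ensures allowed (game_value allowed) /\
  forall k, cop_ensures allowed k -> game_value allowed <= k.
Proof.
move=> sl sa; rewrite /game_value.
case: arg_minnP => [|i /asboolP iP imin].
  by apply/asboolP; exists s; split=> // t _; exact: max_card.
split=> // k kP; have [kT|Tk] := ltnP k #|T|.+1.
  by apply: (imin (Ordinal kT)); apply/asboolP.
by apply: leq_trans (ltnW Tk); rewrite -ltnS ltn_ord.
Qed.

Lemma pass_strategy (x : T) :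
  exists2 s, cop_legal s & passes_in_round1 s.
Proof.
exists (fun h => (last (x, x) h).1) => // h c r.
by rewrite last_rcons /step eqxx.
Qed.

End Game.

(* Main.v *)
(* The cop plays two games at once, an optimal one on G and one on H that is
   optimal among those with a pass in round 1.  He opens with a move in G; later
   he answers a robber move in G (or a pass) by his move in the G-game and a
   robber move in H by his move in the H-game, so each projection is a genuine
   play.  If both strategies catch the robber whenever they can, a captured
   projection stays captured, so at the last damaging time of the robber one of
   the two projections has never been captured; hence all damage so far lies in
   D * H with |D| <= dmg G, or in G * D with |D| <= dmg' H. *)

Require Import Defs.
From mathcomp Require Import all_boot.
From mathcomp Require Import boolp.

Set Implicit Arguments.
Unset Strict Implicit.
Unset Printing Implicit Defensive.

Section Pursuit.

Variables (T : finType) (e : rel T).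

(* A pursuit maps the list of the robber's positions in rounds 0, ..., n-1 to the
   cop's position in round n. *)
Definition pursuit (k : seq T -> T) : Prop :=
  forall w x, step e (k w) (k (rcons w x)).

(** Capture is tested only at the end of the walk, so an earlier capture does not excuse a long
    walk; this suits cops that never release a caught robber. *)
Definition confines (k : seq T -> T) (m : nat) : Prop :=
  forall w x, sorted (step e) (rcons w x) -> k (rcons w x) != x ->
    #|rcons w x| <= m.

Lemma step_refl x : step e x x.
Proof. by rewrite /step eqxx. Qed.

Lemma sorted_rcons2 w x y :
  sorted (step e) (rcons (rcons w x) y) =
  sorted (step e) (rcons w x) && step e x y.
Proof. by case: w => [|a w] /=; rewrite ?andbT // rcons_path last_rcons. Qed.

Definition play (s : cop_strategy T) (w : seq T) : seq (T * T) :=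
  foldl (fun h r => rcons h (s h, r)) [::] w.

Lemma play_rcons s w x : play s (rcons w x) = rcons (play s w) (s (play s w), x).
Proof. by rewrite /play foldl_rcons. Qed.

Lemma size_play s w : size (play s w) = size w.
Proof. by elim/last_ind: w => // w x IH; rewrite play_rcons !size_rcons IH. Qed.

(* A capture is never postponed, except that in round 1 the cop catches only by
   passing; the round-1 exception keeps strategies that pass in round 1 so. *)
Definition greedy (s : cop_strategy T) : cop_strategy T := fun h =>
  let p := last (s h, s h) h in
  if (p.1 == p.2) || (1 < size h) && e p.1 p.2 then p.2 else s h.

Lemma greedy_legal s : cop_legal e s -> cop_legal e (greedy s).
Proof.
move=> sl h c r; rewrite /greedy last_rcons /=; case: ifP => [|_]; last exact: sl.
by rewrite /step eq_sym => /orP[->|/andP[_ ->]]; rewrite ?orbT.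
Qed.

Lemma greedy_pass s : passes_in_round1 s -> passes_in_round1 (greedy s).
Proof. by move=> sp c r; rewrite /greedy /= orbF; case: eqP => [->|]. Qed.

Lemma greedy_neq s h c r :
  greedy s (rcons h (c, r)) != r -> greedy s (rcons h (c, r)) = s (rcons h (c, r)).
Proof. by rewrite /greedy last_rcons /=; case: ifP => //; rewrite eqxx. Qed.

(** The history has at least two entries here, so the round-1 exception in [greedy] does not apply
    and the cop shadows the robber. *)
Lemma greedy_keeps s w x y : step e x y ->
  greedy s (play (greedy s) (rcons w x)) = x ->
  greedy s (play (greedy s) (rcons (rcons w x) y)) = y.
Proof.
move=> xy kx; rewrite play_rcons kx /greedy last_rcons /= size_rcons size_play.
by rewrite size_rcons /= eq_sym -[_ || _]/(step e x y) xy.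
Qed.

Lemma greedy_still s w x :
  greedy s (play (greedy s) w) = x ->
  greedy s (play (greedy s) (rcons w x)) = x.
Proof. by move=> kx; rewrite play_rcons kx /greedy last_rcons /= eqxx. Qed.

(** By [greedy_keeps] an earlier capture would persist to the end of the walk. *)
Lemma greedy_free s w x : sorted (step e) (rcons w x) ->
  greedy s (play (greedy s) (rcons w x)) != x ->
  forall u y v, rcons w x = rcons u y ++ v ->
  greedy s (play (greedy s) (rcons u y)) != y.
Proof.
move=> + + u y v; elim/last_ind: v w x => [|v z IH] w x sw kx.
  by rewrite cats0 => /rcons_inj[<- <-].
rewrite -rcons_cat => /rcons_inj[wE _].
case/lastP: w => [|w a] in sw kx wE *; first by case: (u) wE.
apply: IH wE; first by move: sw; rewrite sorted_rcons2 => /andP[].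
apply: contra kx => /eqP ka; apply/eqP/greedy_keeps => //.
by move: sw; rewrite sorted_rcons2 => /andP[].
Qed.

(** Staying put when the script [rho] is not a walk makes the strategy legal for every [rho]; the
    default [y] makes round 0 unrestricted. *)
Definition follow (rho : nat -> T) : robber_strategy T := fun h _ =>
  let y := rho (size h) in
  let r := (last (y, y) h).2 in if step e r y then y else r.

Lemma follow_legal rho : robber_legal e (follow rho).
Proof.
move=> h c r c'; rewrite /follow last_rcons /=.
by case: ifP => // _; apply: step_refl.
Qed.

(** Let a robber walk along [rcons w x] against [s]. Since [greedy s] never catches him there, it
    never deviates from [s], so the two plays coincide and every vertex of the walk is damaged. *)
Lemma cop_damage_confines s m : cop_legal e s ->
  (forall t, robber_legal e t -> damage s t <= m) ->
  confines (fun w => greedy s (play (greedy s) w)) m.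
Proof.
move=> sl sm w x sw kx.
pose W := rcons w x; pose rho := nth x W; pose t := follow rho.
apply: leq_trans (sm _ (follow_legal rho)); rewrite -/t.
have takeS j : j < size W -> take j.+1 W = rcons (take j W) (rho j).
  by move=> jW; rewrite (take_nth x).
have free j : j < size W -> greedy s (play (greedy s) (take j.+1 W)) != rho j.
  move=> jW; rewrite takeS //; apply: (greedy_free sw kx) (drop j.+1 W) _.
  by rewrite -takeS // cat_take_drop.
(* This excludes a robber stepping onto the cop: the cop would stay there, contradicting [free]. *)
have still j : j < size W -> greedy s (play (greedy s) (take j W)) != rho j.
  move=> jW; apply: contra (free j jW) => /eqP kj.
  by apply/eqP; rewrite takeS //; apply: greedy_still.
have agree j : j <= size W ->
    greedy s (play (greedy s) (take j W)) = s (play (greedy s) (take j W)).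
  case: j => [|j] jW; first by rewrite take0 /greedy /= eqxx.
  by move: (free j jW); rewrite takeS // play_rcons; apply: greedy_neq.
have hist j : j <= size W -> history s t j = play (greedy s) (take j W).
  elim: j => [|j IH] jW; first by rewrite take0.
  rewrite /= (IH (ltnW jW)) takeS // play_rcons agree ?(ltnW jW) //.
  congr (rcons _ (_, _)); rewrite /t /follow size_play size_take jW.
  case: j => [|j] in jW {IH} *; first by rewrite take0 /= step_refl.
  rewrite takeS ?(ltnW jW) // play_rcons last_rcons /=.
  suff -> : step e (rho j) (rho j.+1) by [].
  by move/(sortedP x): sw; apply.
have robE j : j < size W -> robber_at s t j = rho j.
  move=> jW; have := hist _ jW; rewrite takeS // play_rcons /=.
  by move=> /rcons_inj[_ _].
have copE j : j <= size W -> cop_at s t j = greedy s (play (greedy s) (take j W)).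
  by move=> jW; rewrite /cop_at hist // agree.
apply/subset_leq_card/subsetP => v vW; rewrite inE; apply/asboolP.
exists (index v W); have iW : index v W < size W by rewrite index_mem.
split=> [|j ji]; first by rewrite robE // /rho nth_index.
have jW : j < size W by apply: leq_ltn_trans iW.
rewrite !copE ?(ltnW jW) // robE //; split; apply/eqP; first exact: still.
exact: free.
Qed.

Lemma play_pursuit s : cop_legal e s -> pursuit (fun w => s (play s w)).
Proof. by move=> sl w x; rewrite play_rcons; apply: sl. Qed.

Definition pursue (k : seq T -> T) : cop_strategy T := fun h =>
  let y := k (unzip2 h) in
  let c := (last (y, y) h).1 in if step e c y then y else c.

Lemma pursue_legal k : cop_legal e (pursue k).
Proof.
move=> h c r; rewrite /pursue last_rcons /=.
by case: ifP => // _; apply: step_refl.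
Qed.

(** At the time [f v] of the last new damage the robber is still free, so his walk up to then has at
    most [m] vertices, and it contains all damaged ones. *)
Lemma confines_ensures k m : pursuit k -> confines k m ->
  cop_ensures e (fun=> True) m.
Proof.
move=> kl km; exists (pursue k); split=> // [|t tl]; first exact: pursue_legal.
set s := pursue k; pose w := mkseq (robber_at s t).
have wS n : w n.+1 = rcons (w n) (robber_at s t n) by rewrite /w mkseqS.
have hist n : unzip2 (history s t n) = w n.
  by elim: n => [//|n IH]; rewrite /= /unzip2 map_rcons wS -IH.
have copE n : cop_at s t n = k (w n).
  elim: n => [|n IH]; rewrite {1}/cop_at {1}/s /pursue hist.
    by rewrite /= step_refl.
  by rewrite /= last_rcons /= -/(cop_at s t n) IH wS kl.
have wsort n : sorted (step e) (w n).
  elim: n => [//|[//|n] IH]; rewrite wS wS sorted_rcons2 -wS IH /=.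
  by rewrite {2}/robber_at /=; apply: tl.
have [v0 v0D | D0] := pickP [in [set v | `[< damaged s t v >]]]; last first.
  by rewrite /damage eq_card0.
(* [f] picks a damaging round for each damaged vertex; 0 is a dummy value. *)
have /choice[f fP] (v : T) : exists n, damaged s t v ->
    robber_at s t n = v /\ uncaptured_after_cop_move s t n.
  by have [[n nP]|nD] := pselect (damaged s t v); [exists n | exists 0].
case: (arg_maxnP f v0D) => v vD0 vmax.
have {vD0} vD : damaged s t v.
  by have : v \in [set v | `[< damaged s t v >]] := vD0; rewrite inE => /asboolP.
have [_ /(_ _ (leqnn _))[_]] := fP v vD; rewrite copE wS => /eqP vfree.
have := wsort (f v).+1; rewrite wS => /km/(_ vfree).
apply: leq_trans; rewrite -wS.
apply/subset_leq_card/subsetP => u uD; have := vmax u uD.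
move: uD; rewrite inE => /asboolP/fP[uE _] fuv; rewrite -uE.
by apply: (map_f (robber_at s t)); rewrite mem_iota.
Qed.

Lemma dmg_ensured : 0 < #|T| ->
  cop_ensures e (fun=> True) (dmg e) /\ cop_ensures e (@passes_in_round1 T) (dmg' e).
Proof.
move=> /card_gt0P[x _]; have [s sl sp] := pass_strategy e x.
by split; [case: (game_valueP sl I) | case: (game_valueP sl sp)].
Qed.

Lemma ensures_confines allowed m : cop_ensures e allowed m ->
  exists k, [/\ pursuit k, confines k m &
    (forall s, allowed s -> passes_in_round1 s) -> forall x, k [:: x] = k [::]].
Proof.
move=> [s [sl sa sm]]; exists (fun w => greedy s (play (greedy s) w)); split.
- exact/play_pursuit/greedy_legal.
- exact: cop_damage_confines.
- by move=> sp x; apply: (greedy_pass (sp s sa)).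
Qed.

End Pursuit.

Section Box.

Variables (G H : finType) (eG : rel G) (eH : rel H).

(** The first case is round 0, whose position opens both walks; later each position extends exactly
    one. *)
Definition split_step (p : seq G * seq H) (q : G * H) : seq G * seq H :=
  if nilp p.2 then ([:: q.1], [:: q.2])
  else if q.2 == last q.2 p.2 then (rcons p.1 q.1, p.2)
  else (p.1, rcons p.2 q.2).

(* A pass of the robber counts as a move in G. *)
Definition split_walk (w : seq (G * H)) : seq G * seq H :=
  foldl split_step ([::], [::]) w.

Lemma split_walk_rcons w q :
  split_walk (rcons w q) = split_step (split_walk w) q.
Proof. exact: foldl_rcons. Qed.

Lemma step_box p q : step (box eG eH) p q ->
  if q.2 == p.2 then step eG p.1 q.1 else (q.1 == p.1) && eH p.2 q.2.
Proof.
case: p q => [a b] [c d]; rewrite /step /box -pair_eqE /pair_eq /= [a == c]eq_sym.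
by rewrite [b == d]eq_sym; do 2 case: eqP => //=; rewrite ?orbF.
Qed.

Lemma step_boxl a b c : step eG a b -> step (box eG eH) (a, c) (b, c).
Proof.
by rewrite /step /box -pair_eqE /pair_eq /= eqxx andbT => /orP[]->; rewrite ?orbT.
Qed.

Lemma step_boxr a c d : step eH c d -> step (box eG eH) (a, c) (a, d).
Proof.
by rewrite /step /box -pair_eqE /pair_eq /= eqxx => /orP[]->; rewrite ?orbT.
Qed.

Lemma split_walkP w q : sorted (step (box eG eH)) (rcons w q) ->
  exists u v, [/\ split_walk (rcons w q) = (rcons u q.1, rcons v q.2),
    sorted (step eG) (rcons u q.1), sorted (step eH) (rcons v q.2) &
    forall p, p \in rcons w q -> p.1 \in rcons u q.1 /\ p.2 \in rcons v q.2].
Proof.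
elim/last_ind: w q => [|w p IH] q.
  exists [::], [::]; split=> // p; rewrite inE => /eqP->.
  by rewrite !inE !eqxx.
rewrite sorted_rcons2 => /andP[/IH[u [v [pE su sv uv]]] pq].
rewrite split_walk_rcons pE /split_step /= /nilp size_rcons last_rcons /=.
case: eqP (step_box pq) => [q2 pq1 | _ /andP[/eqP q1 pq2]].
  exists (rcons u p.1), v; rewrite q2 sorted_rcons2 su; split=> // z.
  rewrite mem_rcons inE => /predU1P[->|/uv[z1 z2]].
    by rewrite !mem_rcons !inE q2 !eqxx.
  by rewrite z2 mem_rcons inE z1 orbT.
exists u, (rcons v p.2); rewrite q1 sorted_rcons2 sv /step pq2 orbT; split=> // z.
rewrite mem_rcons inE => /predU1P[->|/uv[z1 z2]].
  by rewrite !mem_rcons !inE q1 !eqxx.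
by rewrite z1 [_ \in rcons (rcons _ _) _]mem_rcons inE z2 orbT.
Qed.

(** The robber's initial position enters both projected games, so both call for a reply in round 1,
    while the cop can move in one factor only: hence the pass in H. Afterwards only one game
    advances per round. *)
Lemma box_pursuit kG kH : pursuit eG kG -> pursuit eH kH ->
  (forall x, kH [:: x] = kH [::]) ->
  pursuit (box eG eH) (fun w => let p := split_walk w in (kG p.1, kH p.2)).
Proof.
move=> lG lH pH w q; rewrite /= split_walk_rcons.
case/lastP: w => [|w p] in q *; rewrite /split_step.
  by rewrite /= pH; apply: (step_boxl (kH [::]) (lG [::] q.1)).
have /negPf-> : ~~ nilp (split_walk (rcons w p)).2.
  rewrite split_walk_rcons /split_step; case: ifP => //= /negbT p2.
  by case: ifP => // _; rewrite /nilp size_rcons.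
by case: ifP => _ /=; [apply/step_boxl/lG | apply/step_boxr/lH].
Qed.

End Box.

Theorem theorem10 (G H : finType) (eG : rel G) (eH : rel H)
  (simpleG : simple_graph eG) (simpleH : simple_graph eH)
  (connectedG : connected_graph eG) (connectedH : connected_graph eH) :
  dmg (box eG eH) <= maxn (dmg eG * #|H|) (dmg' eH * #|G|).
Proof.
have [[G0 _] [H0 _]] := (connectedG, connectedH).
have [/ensures_confines[kG [lG cG _]] _] := dmg_ensured eG G0.
have [_ /ensures_confines[kH [lH cH /(_ (fun _ => id)) pH]]] :=
  dmg_ensured eH H0.
have GH0 : 0 < #|{: G * H}| by rewrite card_prod muln_gt0 G0.
have /card_gt0P[z _] := GH0.
have [s sl _] := pass_strategy (box eG eH) z.
apply: (game_valueP (allowed := fun=> True) sl I).2.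
apply: (confines_ensures (box_pursuit lG lH pH)).
move=> w q /split_walkP[u [v [-> su sv uv]]] /=.
(* A cop off the robber's vertex misses him in some coordinate; that projected walk is confined, and
   the other coordinate is bounded trivially. *)
rewrite -pair_eqE negb_and leq_max => /orP[/(cG _ _ su) uk | /(cH _ _ sv) vk].
  apply/orP; left; apply: (@leq_trans #|[predX rcons u q.1 & H]|).
    by apply/subset_leq_card/subsetP => p /uv[p1 _]; rewrite !inE p1.
  by rewrite cardX leq_mul.
apply/orP; right; apply: (@leq_trans #|[predX G & rcons v q.2]|).
  by apply/subset_leq_card/subsetP => p /uv[_ p2]; rewrite !inE p2.
by rewrite cardX mulnC leq_mul.
Qed.
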